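(* For any weakly increasing range map $\delta$ and $n\geq 0$, the poset $\mathsf{Hi}_\delta(n)$ is (i) straight, where $u\in\mathsf{Hi}_\delta(n)$ is covered by $v\in\mathsf{Hi}_\delta(n)$ if and only if there is an $i\in[n]$ such that $v$ is obtained from $u$ by replacing $u_i$ by $u_i+1$; (ii) coated; (iii) nested (when $n\geq 1$); (iv) graded, where the rank of $u$ is its weight $u_1+\cdots+u_n$; (v) EL-shellable; (vi) a sublattice of $\mathsf{Cl}_\delta(n)$; (vii) constructible by interval doubling.
   Context: $\mathbb{N}=\{0,1,2,\dots\}$, $[n]=\{1,\dots,n\}$. A range map is a map $\delta:\mathbb{N}\setminus\{0\}\to\mathbb{N}$; it is weakly increasing if $\delta(i)\leq\delta(i+1)$ for all $i\geq 1$. A $\delta$-cliff of size $n$ is a word $u=u_1\cdots u_n$ of nonnegative integers with $u_i\leq\delta(i)$ for all $i$; $\mathsf{Cl}_\delta(n)$ is the set of them, ordered componentwise ($u\preccurlyeq v$ iff $u_i\leq v_i$ for all $i$); it is a lattice with componentwise min and max as meet and join. $\mathsf{Hi}_\delta(n)$ is the set of $\delta$-cliffs $u$ of size $n$ with $u_i\leq u_{i+1}$ for all $i\in[n-1]$ ($\delta$-hills), with the induced order. For a subposet $\mathcal{P}$ of $\mathsf{Cl}_\delta(n)$: - $\mathcal{P}$ is straight if whenever $v$ covers $u$ in $\mathcal{P}$, the words $u$ and $v$ differ at exactly one position. - $\mathcal{P}$ is coated if for all $u\preccurlyeq v$ in $\mathcal{P}$ and all $i\in[n-1]$, $u_1\cdots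 u_iv_{i+1}\cdots v_n\in\mathcal{P}$. - (For $n\geq 1$ and $\mathcal{P}$ nonempty.) Let $\mathrm{m}(\mathcal{P}) := \max\{u_n:u\in\mathcal{P}\}$, $\mathcal{P}_a:=\{u\in\mathcal{P}:u_n=a\}$, and $\mathcal{P}_{a,b}:=\{wb : wa\in\mathcal{P}_a\}$ (replace the last letter $a$ by $b$). $\mathcal{P}$ is nested if for every $a\in\{0,\dots,\mathrm{m}(\mathcal{P})\}$, the word $0^{n-1}a$ belongs to $\mathcal{P}$, and $\mathcal{P}_{a,\mathrm{m}(\mathcal{P})}$ is both a subset and an interval of $\mathcal{P}$ (i.e. of the form $\{z\in\mathcal{P}:x\preccurlyeq z\preccurlyeq y\}$ for some $x,y \in \mathcal{P}$). EL-shellability. Let $\lambda$ be a map from the covering pairs of a poset $\mathcal{P}$ to a poset $\Lambda$. The label sequence of a saturated chain is the sequence of labels of its successive covering pairs; the chain is $\lambda$-increasing if this sequence is strictly increasing. $\lambda$ is an EL-labeling if for all $x\preccurlyeq y$ in $\mathcal{P}$ there is exactly one $\lambda$-increasing saturated chain from $x$ to $y$, and its label sequence is lexicographically minimal among those of all saturated chains from $x$ to $y$. $\mathcal{P}$ is EL-shellable if it has a least and a greatest element and admits an EL-labeling for some poset $\Lambda$. Interval doubling. Let $\mathbf{2}$ be the chain $\{0<1\}$. For an interval $I$ of a poset $(\mathcal{P},\preccurlyeq)$, $\mathcal{P}[I]:=(\mathcal{P}\setminus I)\sqcup(I\times\mathbf{2})$, ordered as follows: elements are compared through their underlying elements of $\mathcal{P}$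 (the underlying element of $(x,a)$ being $x$), except that $(x,a)\leq(y,b)$ for $x,y\in I$ iff $x\preccurlyeq y$ and $a\leq b$. A lattice is constructible by interval doubling if it is isomorphic to a poset obtained from the one-element lattice by a finite sequence of interval doublings. *)

(* Defs.v *)
From HB Require Import structures.
From mathcomp Require Import all_boot all_order.

Set Implicit Arguments.
Unset Strict Implicit.
Unset Printing Implicit Defensive.

Import Order.TTheory.
Local Open Scope order_scope.

(* A subposet of a poset T is a predicate P on T, with the induced order. *)
Section Subposets.
Context {d : Order.disp_t} {T : porderType d}.
Implicit Types (P Q : {pred T}) (x y z : T) (c : seq T).

Definition covers P x y : Prop :=
  [/\ x \in P, y \in P, x < y & forall z, z \in P -> ~~ (x < z < y)].

Definition minimal P x : Prop := x \in P /\ forall y, y \in P -> ~~ (y < x).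
Definition maximal P x : Prop := x \in P /\ forall y, y \in P -> ~~ (x < y).

(* x :: c is a saturated chain of P ending at y. *)
Fixpoint saturated P x c y : Prop :=
  if c is z :: c' then covers P x z /\ saturated P z c' y else x = y.

Definition graded P : Prop :=
  exists k : nat, forall x c y,
    minimal P x -> maximal P y -> saturated P x c y -> size c = k.

Definition rank_function P (rk : T -> nat) : Prop :=
  (forall x, minimal P x -> rk x = 0%N) /\
  (forall x y, covers P x y -> rk y = (rk x).+1).

(* Only the values of lab on covering pairs matter; pairmap lab x c is the
   label sequence of the chain x :: c. *)
Definition EL_labeling d' (L : porderType d') P (lab : T -> T -> L) : Prop :=
  forall x y, x \in P -> y \in P -> x <= y ->
  exists2 c,
    unique (fun c' => saturated P x c' y /\ sorted <%O (pairmap lab x c')) c &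
    forall c', saturated P x c' y ->
      (pairmap lab x c : seqlexi L) <= (pairmap lab x c' : seqlexi L).

Definition EL_shellable P : Prop :=
  [/\ exists2 b, b \in P & forall x, x \in P -> b <= x,
      exists2 t, t \in P & forall x, x \in P -> x <= t &
      exists (d' : Order.disp_t) (L : porderType d') (lab : T -> T -> L),
        EL_labeling P lab].

End Subposets.

(* P is a sublattice of Q, where Q is itself assumed to be closed under the
   operations of T, which are thus the operations of the lattice Q. *)
Definition sublattice d (T : latticeType d) (P Q : {pred T}) : Prop :=
  [/\ {subset P <= Q}, {in P &, forall x y, x `&` y \in P} &
      {in P &, forall x y, x `|` y \in P}].

(* The doubling P[I] of the interval I = [a, b] of P; false < true is the
   two-element chain. *)
Definition doubling d (P : porderType d) (a b : P) : Type :=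
  ({x : P | ~~ (a <= x <= b)} + {x : P | a <= x <= b} * bool)%type.

Section Doubling.
Context {d : Order.disp_t} {P : porderType d} {a b : P}.

Definition underlying (s : doubling a b) : P :=
  match s with inl x => val x | inr (x, _) => val x end.

Definition doubling_le (s t : doubling a b) : bool :=
  (underlying s <= underlying t) &&
  match s, t with inr (_, i), inr (_, j) => i ==> j | _, _ => true end.

Lemma doubling_le_refl : reflexive doubling_le.
Proof. by case=> [x|[x i]]; rewrite /doubling_le /= lexx ?implybb. Qed.

Lemma doubling_le_anti : antisymmetric doubling_le.
Proof.
case=> [[x hx]|[[x hx] i]] [[y hy]|[[y hy] j]]; rewrite /doubling_le /=.
- rewrite !andbT => /le_anti exy; subst y; congr inl; exact: val_inj.
- by rewrite !andbT => /le_anti exy; subst y; case/negP: (hx).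
- by rewrite !andbT => /le_anti exy; subst y; case/negP: (hy).
- case/andP=> /andP[xy ij] /andP[yx ji].
  have exy : x = y by apply/le_anti; rewrite xy yx.
  subst y; congr (inr (_, _)); first exact: val_inj.
  by case: i j ij ji {xy yx} => [] [].
Qed.

Lemma doubling_le_trans : transitive doubling_le.
Proof.
move=> t s u /andP[st ist] /andP[tu itu].
rewrite /doubling_le (le_trans st tu) /=.
case: s t u st tu ist itu => [x|[[x hx] i]] [[y hy]|[[y hy] j]] [z|[[z hz] k]] //=.
- move=> xy yz _ _; case/negP: hy; case/andP: hx => ax _; case/andP: hz => _ zb.
  by rewrite (le_trans ax xy) (le_trans yz zb).
- by move=> _ _; case: i j k => [] [] [].
Qed.

End Doubling.

HB.instance Definition _ d (P : porderType d) (a b : P) :=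
  Choice.copy (doubling a b)
    ({x : P | ~~ (a <= x <= b)} + {x : P | a <= x <= b} * bool)%type.
HB.instance Definition _ d (P : porderType d) (a b : P) :=
  Order.Le_isPOrder.Build d (doubling a b)
    doubling_le_refl doubling_le_anti doubling_le_trans.

Inductive obtained_by_doublings : forall d, porderType d -> Prop :=
| obtained_one : obtained_by_doublings 'I_1
| obtained_doubling d (P : porderType d) (a b : P) :
    a <= b -> obtained_by_doublings P -> obtained_by_doublings (doubling a b).

(* f is an isomorphism from Q onto P. *)
Definition constructible_by_interval_doubling d (T : porderType d)
    (P : {pred T}) : Prop :=
  exists (d' : Order.disp_t) (Q : porderType d') (f : Q -> T),
    [/\ obtained_by_doublings Q, {mono f : x y / x <= y} &
        forall u, u \in P <-> exists x, f x = u].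

(* Words of length n, ordered componentwise; meets and joins are computed
   componentwise. Positions are 0-based: the i-th letter of u is tnth u i.-1. *)
Notation word n := (n.-tupleprod nat).

Definition weakly_increasing (delta : nat -> nat) : Prop :=
  forall i, (0 < i)%N -> (delta i <= delta i.+1)%N.

(* A range map delta is only used at positive arguments; delta 0 is junk. *)
Definition cliff (delta : nat -> nat) n : {pred word n} :=
  [pred u : word n | [forall i : 'I_n, (tnth u i <= delta i.+1)%N]].
Arguments cliff delta n : clear implicits.

Lemma cliff_meet delta n :
  {in cliff delta n &, forall u v, u `&` v \in cliff delta n}.
Proof.
move=> u v /forallP hu _; apply/forallP=> i.
by rewrite meetEtprod tnth_mktuple; apply: leq_trans (hu i); rewrite geq_minl.
Qed.

Lemma cliff_join delta n :
  {in cliff delta n &, forall u v, u `|` v \in cliff delta n}.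
Proof.
move=> u v /forallP hu /forallP hv; apply/forallP=> i.
by rewrite joinEtprod tnth_mktuple geq_max hu hv.
Qed.

Definition hill (delta : nat -> nat) n : {pred word n} :=
  [pred u : word n | (u \in cliff delta n) && sorted leq u].
Arguments hill delta n : clear implicits.

Definition weight n (u : word n) : nat := (\sum_(i < n) tnth u i)%N.

Section WordSubposets.
Context {n : nat}.
Implicit Types P : {pred word n}.

Definition straight P : Prop :=
  forall u v, covers P u v -> exists! i : 'I_n, tnth u i <> tnth v i.

Definition increment (u : word n) (i : 'I_n) : word n :=
  [tuple if j == i then (tnth u j).+1 else tnth u j | j < n].

(* u_1 ... u_i v_(i+1) ... v_n *)
Definition splice (u v : word n) (i : nat) : word n :=
  [tuple if (j < i)%N then tnth u j else tnth v j | j < n].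

Definition coated P : Prop :=
  forall u v, u \in P -> v \in P -> u <= v ->
  forall i, (0 < i < n)%N -> splice u v i \in P.

End WordSubposets.

Section Nested.
Context {n : nat}.
Implicit Types P : {pred word n.+1}.

Definition append (w : n.-tuple nat) (a : nat) : word n.+1 :=
  [tuple of rcons w a].

Definition is_max_last P (m : nat) : Prop :=
  (exists2 u, u \in P & tnth u ord_max = m) /\
  (forall u, u \in P -> (tnth u ord_max <= m)%N).

(* P_(a,b) *)
Definition relast P (a b : nat) (z : word n.+1) : Prop :=
  exists2 w : n.-tuple nat, append w a \in P & z = append w b.

Definition is_interval P (S : word n.+1 -> Prop) : Prop :=
  exists x y, [/\ x \in P, y \in P & forall z, S z <-> z \in P /\ x <= z <= y].

Definition nested P : Prop :=
  exists2 m, is_max_last P m &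
  forall a, (a <= m)%N ->
    [/\ append [tuple of nseq n 0%N] a \in P,
        forall z, relast P a m z -> z \in P &
        is_interval P (relast P a m)].

End Nested.

(* Main.v *)
Require Import Defs.
From mathcomp Require Import all_boot all_order.
From mathcomp Require Import zify.
Import Order.TTheory.

Set Implicit Arguments.
Unset Strict Implicit.
Unset Printing Implicit Defensive.

(** Hills behave like the order ideals of a finite poset: a hill is built from
the zero word by raising one letter by one at a time, and every raise may be
seen as adding the pair (position, new value).

Everything about chains comes from [rightmost_raise]: if u < v are hills and i
is the last position where they differ, then u_i can be raised without leaving
the hills below v, because u_i + 1 <= v_i <= v_{i+1} = u_{i+1}. So a cover is a
single raise, which gives straightness, and the weight is a rank function.

For the EL-labeling, the raise of u_i gets the label (n - i, u_i) in the
lexicographic order. Raising the rightmost possible letter first gives a chain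
that takes the smallest available label at every step, hence is
lexicographically minimal, and whose labels increase. It is the only such chain:
a chain that begins by raising a letter further left must raise the rightmost
one later, and then meets a label smaller than its first one ([mem_label]).

For interval doubling, follow a saturated chain of bounds d from the zero word
to the greatest hill, looking at the hills below d. When d_i is raised by one,
the hills that appear are the increments at i of those w <= d with w_i = d_i
whose later letters all exceed d_i. These w form an interval with top d, and
adding their increments doubles it ([constructible_below_increment]).

Coatedness and closure under meet and join are letterwise. For nestedness, a
word wa is a hill exactly when w is a hill with letters at most a, and a is at
most the bound for the last position; so the last letter can be changed to the
maximal one, and the words obtained form an interval. *)

(** * Words and their increments *)

Section Words.
Variable n : nat.
Implicit Types u v w : word n.

Lemma word_leP u v :
  reflect (forall i, tnth u i <= tnth v i) (u <= v)%O.
Proof. by rewrite leEtprod; apply: forallP. Qed.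

Lemma tnth_increment u (i j : 'I_n) :
  tnth (increment u i) j = if j == i then (tnth u j).+1 else tnth u j.
Proof. by rewrite tnth_mktuple. Qed.

Lemma lt_increment u (i : 'I_n) : (u < increment u i)%O.
Proof.
rewrite lt_neqAle; apply/andP; split.
  apply/eqP => /(congr1 (fun w : word n => tnth w i)).
  by rewrite tnth_increment eqxx; lia.
by apply/word_leP => j; rewrite tnth_increment; case: eqP; lia.
Qed.

Lemma weight_increment u (i : 'I_n) : weight (increment u i) = (weight u).+1.
Proof.
rewrite /weight (bigD1 i) //= [in RHS](bigD1 i) //= tnth_increment eqxx addSn.
by congr (_ + _).+1; apply: eq_bigr => j /negPf ji; rewrite tnth_increment ji.
Qed.

Lemma weight_lt u v : (u < v)%O -> weight u < weight v.
Proof.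
rewrite lt_neqAle => /andP[neq_uv /word_leP le_uv].
have [le_w eq_w] : weight u <= weight v ?= iff [forall i, tnth u i == tnth v i].
  by apply: leqif_sum => i _; apply/leqif_eq/le_uv.
rewrite ltn_neqAle le_w andbT eq_w; apply: contra neq_uv => /forallP eq_uv.
by apply/eqP/eq_from_tnth => i; apply/eqP/eq_uv.
Qed.

End Words.

(** * Doubling an interval of a subposet *)

Section Doubling.
Variables (d : Order.disp_t) (T : porderType d) (P P' : {pred T}).
Variables (a b : T) (up : T -> T).
Let I := [pred w | (w \in P') && (a <= w <= b)%O].

(** This recognizes a doubling inside an ambient poset, where [up w] stands for
the upper copy of w. For w in the interval and w <= x, the element x lies in the
interval exactly when x <= b; hence the single comparison rule with ~~ (x <= b)
covers both x inside the interval, where up w <= x must fail, and x outside. *)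
Lemma constructible_doubling :
  a \in P' -> b \in P' -> (a <= b)%O ->
  {in I &, {mono up : w w' / (w <= w')%O}} ->
  {in P' & I, forall x w, (x <= up w)%O = (x <= w)%O} ->
  {in P' & I, forall x w, (up w <= x)%O = (w <= x)%O && ~~ (x <= b)%O} ->
  (forall u, u \in P <-> u \in P' \/ exists2 w, w \in I & u = up w) ->
  constructible_by_interval_doubling P' -> constructible_by_interval_doubling P.
Proof.
move=> aP bP le_ab upM le_up up_le defP [d' [Q [f [dblQ fM defP']]]].
have fP q : f q \in P' by apply/defP'; exists q.
have [[a' def_a] [b' def_b]] := ((defP' a).1 aP, (defP' b).1 bP); subst a b.
have fI q : (a' <= q <= b')%O -> f q \in I by rewrite inE fP /= !fM.
exists d', (doubling a' b'), (fun s => match s with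
  | inl x => f (val x)
  | inr (x, i) => if i then up (f (val x)) else f (val x) end).
split.
- by apply: obtained_doubling => //; rewrite -fM.
- have leE (s t : doubling a' b') : (s <= t)%O = doubling_le s t by [].
  case=> [[x hx]|[[x hx] i]] [[y hy]|[[y hy] j]];
    rewrite leE /doubling_le /= ?andbT.
  + exact: fM.
  + by case: j; rewrite ?(le_up _ _ (fP _) (fI _ hy)) fM.
  + case: i; rewrite ?(up_le _ _ (fP _) (fI _ hx)) !fM //.
    case: (boolP (x <= y)%O) => //= le_xy; case/andP: hx => ax _.
    by move: hy; rewrite (le_trans ax le_xy).
  + have [Ix Iy] := (fI _ hx, fI _ hy); case/andP: (hy) => _ yb.
    case: i j => [] []; rewrite ?andbT ?andbF.
    * by rewrite upM // fM.
    * by rewrite up_le ?fP // !fM yb andbF.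
    * by rewrite le_up ?fP // fM.
    * exact: fM.
move=> u; rewrite defP; split.
- case=> [/defP'[q <-]|[w /andP[/defP'[q <-]]]].
    case: (boolP (a' <= q <= b')%O) => hq.
      by exists (inr (Sub q hq, false)).
    by exists (inl (Sub q hq)).
  by rewrite !fM => hq ->; exists (inr (Sub q hq, true)).
- case=> [[[q hq]|[[q hq] []]]] /= <-; [by left | right | by left].
  by exists (f q); rewrite ?fI.
Qed.
End Doubling.

(** * Hills and their covering relation *)

Section Hills.
Variables (delta : nat -> nat) (n : nat).
Hypothesis delta_incr : weakly_increasing delta.
Notation H := (hill delta n).
Implicit Types u v w : word n.

Lemma hillP u :
  reflect ((forall i, tnth u i <= delta i.+1) /\
           {homo tnth u : i j / i <= j}) (u \in H).
Proof.
apply: (iffP andP) => -[hu su]; split.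
- exact/forallP.
- move=> i j le_ij; rewrite !(tnth_nth 0).
  by apply: (sorted_leq_nth leq_trans leqnn 0 su);
    rewrite ?inE ?size_tuple ?ltn_ord.
- exact/forallP.
- apply/(sortedP 0) => i; rewrite size_tuple => lt_in.
  have := su (Ordinal (ltnW lt_in)) (Ordinal lt_in) (leqnSn i).
  by rewrite !(tnth_nth 0).
Qed.

Lemma delta_homo : {homo (fun i => delta i.+1) : i j / i <= j}.
Proof. by apply: homo_leq => [//|y x z|i]; [apply: leq_trans | apply: delta_incr]. Qed.

Definition bottom : word n := [tuple 0 | i < n].
Definition top : word n := [tuple delta i.+1 | i < n].

Lemma bottom_hill : bottom \in H.
Proof. by apply/hillP; split=> [i|i j _]; rewrite !tnth_mktuple. Qed.

Lemma top_hill : top \in H.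
Proof.
by apply/hillP; split=> [i|i j]; rewrite !tnth_mktuple //; apply: delta_homo.
Qed.

Lemma bottom_le u : (bottom <= u)%O.
Proof. by apply/word_leP => i; rewrite tnth_mktuple. Qed.

Lemma le_top u : u \in H -> (u <= top)%O.
Proof. by case/hillP=> hu _; apply/word_leP => i; rewrite tnth_mktuple. Qed.

(** The last position where u and v differ is the place where u can always be
raised towards v: the letters to its right already have their values in v. *)
Lemma rightmost_raise u v : u \in H -> v \in H -> (u < v)%O ->
  exists i : 'I_n, [/\ tnth u i < tnth v i,
    forall j : 'I_n, i < j -> tnth u j = tnth v j,
    increment u i \in H & (increment u i <= v)%O].
Proof.
move=> /hillP[_ mu] /hillP[dv mv]; rewrite lt_neqAle => /andP[neq_uv /word_leP le_uv].
have [i0 lt_i0] : exists i, tnth u i < tnth v i.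
  apply/existsP; apply: contraR neq_uv; rewrite negb_exists => /forallP ge_uv.
  apply/eqP/eq_from_tnth => i; apply/eqP.
  by rewrite eqn_leq le_uv leqNgt ge_uv.
have [i lt_i max_i] := @arg_maxnP _ i0 (fun i => tnth u i < tnth v i) val lt_i0.
have eq_j (j : 'I_n) : i < j -> tnth u j = tnth v j.
  move=> lt_ij; apply/eqP; rewrite eqn_leq le_uv leqNgt.
  by apply/negP => /max_i; rewrite /geq /= leqNgt lt_ij.
have le_iv : (increment u i <= v)%O.
  by apply/word_leP => j; rewrite tnth_increment; case: eqP => [->|].
exists i; split=> //; apply/hillP; split=> [j|j k le_jk].
  exact: leq_trans (word_leP _ _ le_iv j) (dv j).
rewrite !tnth_increment; have := mu _ _ le_jk.
case: eqP => [eq_ji|_]; case: eqP => [_|/eqP neq_ki] //; last by move/leqW.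
subst j => _; rewrite (eq_j k); first exact: leq_trans lt_i (mv _ _ le_jk).
by rewrite ltn_neqAle le_jk andbT eq_sym.
Qed.

(** An increment covers because weight is strictly monotone and grows by one;
the converse is [rightmost_raise]. *)
Lemma covers_hillP u v : u \in H -> v \in H ->
  covers H u v <-> exists i, v = increment u i.
Proof.
move=> hu hv; split=> [[_ _ lt_uv no_z]|[i def_v]].
  have [i [_ _ hi le_iv]] := rightmost_raise hu hv lt_uv.
  exists i; apply/eqP; rewrite eq_sym; apply: contraR (no_z _ hi) => neq_iv.
  by rewrite lt_increment lt_neqAle neq_iv.
subst v; split=> [//|//||z _]; first exact: lt_increment.
apply/andP => -[/weight_lt uz /weight_lt].
by rewrite weight_increment ltnS leqNgt uz.
Qed.

Lemma covers_increment u v : covers H u v -> exists i, v = increment u i.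
Proof. by move=> cuv; case: (cuv) => hu hv _ _; apply/covers_hillP. Qed.

Lemma saturated_le u c v : saturated H u c v -> (u <= v)%O.
Proof.
elim: c u => [u -> //|w c IHc u /= [[_ _ lt_uw _] /IHc le_wv]].
exact: le_trans (ltW lt_uw) le_wv.
Qed.

Lemma saturated_weight u c v :
  saturated H u c v -> weight v = weight u + size c.
Proof.
elim: c u => [u ->|w c IHc u /= [/covers_increment[i ->] /IHc ->]].
  by rewrite addn0.
by rewrite weight_increment addSnnS.
Qed.

(** * The EL-labeling *)

(** Only the label of a cover matters. There both sums have a single term, so
that the label is the pair (n - i, u_i) where i is the raised position; the sums
avoid having to choose i for unrelated words. *)
Definition label u v : nat *l nat :=
  (\sum_(i < n | tnth u i != tnth v i) (n - i),
   \sum_(i < n | tnth u i != tnth v i) tnth u i).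

Lemma label_increment u i : label u (increment u i) = (n - i, tnth u i).
Proof.
have diff j : (tnth u j != tnth (increment u i) j) = (j == i).
  by rewrite tnth_increment; case: (j == i); rewrite ?eqxx // neq_ltn ltnSn.
by rewrite /label !(eq_bigl _ _ diff) !big_pred1_eq.
Qed.

(** The first time a chain raises the letter at i, this letter still has its
initial value. *)
Lemma mem_label u c v i : saturated H u c v -> tnth u i < tnth v i ->
  (n - i, tnth u i) \in pairmap label u c.
Proof.
elim: c u => [u ->|w c IHc u /= [/covers_increment[j ->] sat_c] lt_i].
  by rewrite ltnn.
rewrite inE label_increment; have [->|neq_ij] := eqVneq i j; first by rewrite eqxx.
apply/orP; right; have := IHc _ sat_c.
by rewrite tnth_increment (negPf neq_ij) => /(_ lt_i).
Qed.

Lemma label_lt (i j : nat) (a b : nat) : j < n ->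
  (((n - i, a) : nat *l nat) < (n - j, b))%O = (j < i) || (i == j) && (a < b).
Proof. rewrite ltxi_pair !leEnat ltEnat /= => lt_jn; apply/idP/idP; lia. Qed.

(** The chain that always raises the rightmost letter still to be raised is the
only increasing one and is lexicographically minimal. *)
Lemma greedy_chain u v : u \in H -> v \in H -> (u <= v)%O -> exists c,
  [/\ saturated H u c v, sorted <%O (pairmap label u c),
      forall c', saturated H u c' v -> sorted <%O (pairmap label u c') -> c = c' &
      forall c', saturated H u c' v ->
        ((pairmap label u c : seqlexi (nat *l nat)) <= pairmap label u c')%O].
Proof.
move=> hu hv; have [k] := ubnP (weight v - weight u).
elim: k u hu => // k IHk u hu lt_k.
rewrite le_eqVlt => /predU1P[eq_uv|lt_uv].
  subst v; exists [::]; split=> // c' /saturated_weight wt_c' _.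
  by apply/esym/size0nil; lia.
have [i [lt_i eq_i hi le_iv]] := rightmost_raise hu hv lt_uv.
have {IHk} [|c [sat_c sort_c uniq_c lex_c]] := IHk _ hi _ le_iv.
  by have := weight_lt lt_uv; rewrite weight_increment; lia.
(* The letters after i have reached their final values: a chain to v cannot
     begin to the right of i. *)
have first w c' : covers H u w -> saturated H w c' v ->
    exists2 j : 'I_n, w = increment u j & tnth u j < tnth v j /\ j <= i.
  move=> /covers_increment[j ->] /saturated_le/word_leP/(_ j).
  rewrite tnth_increment eqxx => lt_j; exists j => //; split=> //.
  by rewrite leqNgt; apply/negP => /eq_i eq_j; move: lt_j; rewrite eq_j ltnn.
exists (increment u i :: c); split.
- by split=> //; apply/covers_hillP => //; exists i.
(* The next step is at i, with a larger value, or to the left of i. *)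
- rewrite /= label_increment.
  case: c sat_c sort_c {uniq_c lex_c} => [//|w c] /= [cov_w sat_c] ->.
  have [j def_w] := covers_increment cov_w; subst w.
  have /word_leP/(_ j) := saturated_le sat_c.
  rewrite !label_increment label_lt // andbT !tnth_increment eqxx.
  case: (ltngtP j i) => [//|lt_ij|/val_inj ->]; last by rewrite !eqxx ltnSn.
  by rewrite -(inj_eq val_inj) gtn_eqF // (eq_i _ lt_ij) ltnn.
- case=> [/= eq_uv|w c' /= [cov_w sat_c'] sort_c']; first by rewrite eq_uv ltxx in lt_uv.
  have [j def_w [lt_j le_ji]] := first _ _ cov_w sat_c'; subst w.
  have [eq_ij|neq_ij] := eqVneq i j.
    by subst j; rewrite (uniq_c c') // (path_sorted sort_c').
  (* The chain raises position i later, with a label below its first one. *)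
  have := mem_label sat_c' (i := i); rewrite tnth_increment (negPf neq_ij).
  move=> /(_ lt_i) lab_i.
  have /allP/(_ _ lab_i) := order_path_min lt_trans sort_c'.
  rewrite label_increment label_lt // => ?.
  by case/eqP: neq_ij; apply: val_inj => /=; lia.
- case=> [/= eq_uv|w c' /= [cov_w sat_c']]; first by rewrite eq_uv ltxx in lt_uv.
  have [j def_w [lt_j le_ji]] := first _ _ cov_w sat_c'; subst w.
  have [eq_ij|neq_ij] := eqVneq i j; first by subst j; rewrite eqhead_lexiE lex_c.
  have lt_lab : (label u (increment u i) < label u (increment u j))%O.
    rewrite !label_increment label_lt // ltn_neqAle le_ji andbT.
    by rewrite (inj_eq val_inj) eq_sym neq_ij.
  by rewrite lexi_cons ltW // lt_geF.
Qed.

Lemma hill_EL_shellable : EL_shellable H.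
Proof.
split; first by exists bottom => [|u _]; [exact: bottom_hill | exact: bottom_le].
  by exists top => [|u]; [exact: top_hill | exact: le_top].
exists _, (nat *l nat)%type, label => u v hu hv le_uv.
have [c [sat_c sort_c uniq_c lex_c]] := greedy_chain hu hv le_uv.
by exists c => //; split=> // c' [sat_c' sort_c']; apply: uniq_c.
Qed.

(** * Straightness, coatedness, rank and lattice structure *)

Lemma hill_straight : straight H.
Proof.
move=> u v /covers_increment[i ->]; exists i; split.
  by rewrite tnth_increment eqxx; apply: n_Sn.
by move=> j; rewrite tnth_increment; case: eqP.
Qed.

Lemma hill_coated : coated H.
Proof.
move=> u v /hillP[du mu] /hillP[dv mv] /word_leP le_uv i _.
apply/hillP; split=> [j|j k le_jk]; rewrite !tnth_mktuple; first by case: ifP.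
case: (ltnP j i) => lt_ji; case: (ltnP k i) => lt_ki; last exact: mv.
- exact: mu.
- exact: leq_trans (le_uv j) (mv _ _ le_jk).
- by move: lt_ki; rewrite ltnNge (leq_trans lt_ji le_jk).
Qed.

Lemma hill_minimal u : minimal H u -> u = bottom.
Proof.
case=> _ /(_ _ bottom_hill); rewrite lt_neqAle bottom_le andbT negbK.
by move/eqP.
Qed.

Lemma hill_maximal u : maximal H u -> u = top.
Proof.
case=> hu /(_ _ top_hill); rewrite lt_neqAle le_top // andbT negbK.
by move/eqP.
Qed.

Lemma weight_rank : rank_function H (@weight n).
Proof.
split=> [u /hill_minimal ->|u v /covers_increment[i ->]]; last exact: weight_increment.
by rewrite /weight big1 // => i _; rewrite tnth_mktuple.
Qed.

Lemma hill_graded : graded H.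
Proof.
exists (weight top) => u c v min_u /hill_maximal -> /saturated_weight ->.
by case: weight_rank => ->.
Qed.

Lemma hill_sublattice : sublattice H (cliff delta n).
Proof.
split=> [u /andP[]//|u v|u v] /hillP[du mu] /hillP[dv mv]; apply/hillP.
  split=> [i|i j le_ij]; rewrite meetEtprod !tnth_mktuple.
    by apply: leq_trans (du i); rewrite geq_minl.
  by rewrite leq_min !geq_min mu ?mv ?orbT.
split=> [i|i j le_ij]; rewrite joinEtprod !tnth_mktuple; first by rewrite geq_max du dv.
by rewrite geq_max !leq_max mu ?mv ?orbT.
Qed.

(** * Constructibility by interval doubling *)

Definition hills_below d : {pred word n} := [pred u in H | (u <= d)%O].

Lemma constructible_below_bottom :
  constructible_by_interval_doubling (hills_below bottom).
Proof.
exists _, 'I_1, (fun=> bottom); split; first exact: obtained_one.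
  by move=> x y; rewrite lexx (ord1 x) (ord1 y) lexx.
move=> u; split=> [/andP[_ le_u]|[_ <-]]; last by rewrite inE bottom_hill lexx.
by exists ord0; apply/le_anti; rewrite bottom_le.
Qed.

Definition decrement u i : word n :=
  [tuple if j == i then (tnth u j).-1 else tnth u j | j < n].

(** The least hill w <= d with w_i = d_i that can be raised at i, when both d and
its increment at i are hills: its letters are 0 before i, then d_i, and d_i + 1
afterwards. It is the lower end of the doubled interval. *)
Definition least_raisable d (i : 'I_n) : word n :=
  [tuple if j < i then 0 else (i < j) + tnth d i | j < n].

(** The new hills u below the raised bound have u_i = d_i + 1. Lowering u_i gives a
hill again, since u_{i-1} <= d_{i-1} <= d_i, and this lowering is inverse to
raising at i on the interval from [least_raisable d i] to d. *)
Lemma constructible_below_increment d i : d \in H -> increment d i \in H ->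
  constructible_by_interval_doubling (hills_below d) ->
  constructible_by_interval_doubling (hills_below (increment d i)).
Proof.
move=> hd hi; have [dd md] := hillP _ hd; have [di mi] := hillP _ hi.
have le_a : (least_raisable d i <= d)%O.
  apply/word_leP => j; rewrite tnth_mktuple; case: ltngtP => //= lt_ij.
    have := mi _ _ (ltnW lt_ij); rewrite !tnth_increment eqxx.
    by rewrite -(inj_eq val_inj) gtn_eqF.
  by rewrite (val_inj lt_ij).
have ha : least_raisable d i \in H.
  apply/hillP; split=> [j|j k le_jk].
    exact: leq_trans (word_leP _ _ le_a j) (dd j).
  rewrite !tnth_mktuple; case: (ltnP j i) => // le_ij.
  rewrite (leq_gtF (leq_trans le_ij le_jk)) leq_add2r.
  by case: (ltnP i j) => // lt_ij; rewrite (leq_trans lt_ij le_jk).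
(* The interval forces w_i = d_i, and leaves room for raising w_i. *)
have atI w : w \in [pred w | (w \in hills_below d) && (least_raisable d i <= w <= d)%O] ->
    [/\ w \in H, (w <= d)%O, tnth w i = tnth d i &
        forall j : 'I_n, i < j -> tnth d i < tnth w j].
  case/andP => /andP[hw le_wd] /andP[/word_leP le_aw _]; split=> // [|j lt_ij].
    apply/eqP; rewrite eqn_leq (word_leP _ _ le_wd).
    by have := le_aw i; rewrite tnth_mktuple ltnn.
  by have := le_aw j; rewrite tnth_mktuple (leq_gtF (ltnW lt_ij)) lt_ij.
apply: (@constructible_doubling _ _ _ _ (least_raisable d i) d (increment^~ i)) => //.
- by rewrite inE ha.
- by rewrite inE hd lexx.
- move=> w w' /atI[_ _ wi _] /atI[_ _ w'i _].
  apply/word_leP/word_leP => le_ww' j; have := le_ww' j;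
    by rewrite !tnth_increment; case: eqP.
- move=> x w /andP[_ /word_leP le_xd] /atI[_ _ wi _].
  apply/word_leP/word_leP => le_xw j; have := le_xw j.
    by rewrite tnth_increment; case: eqP => // ->; rewrite wi le_xd.
  by rewrite tnth_increment; case: eqP => // _ /leqW.
- move=> x w /andP[_ le_xd] /atI[_ _ wi _]; rewrite le_xd andbF.
  apply/negP => /word_leP/(_ i); rewrite tnth_increment eqxx wi.
  by rewrite ltnNge (word_leP _ _ le_xd).
move=> u; split=> [/andP[hu /word_leP le_ud]|].
  have [du mu] := hillP _ hu.
  have [le_i|lt_i] := leqP (tnth u i) (tnth d i).
    left; rewrite inE hu; apply/word_leP => j; have := le_ud j.
    by rewrite tnth_increment; case: eqP => // ->.
  have ui : tnth u i = (tnth d i).+1.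
    apply/eqP; rewrite eqn_leq lt_i andbT; have := le_ud i.
    by rewrite tnth_increment eqxx.
  right; exists (decrement u i); last first.
    apply: eq_from_tnth => j; rewrite tnth_increment tnth_mktuple.
    by case: eqP => // ->; rewrite ui.
  have le_wd : (decrement u i <= d)%O.
    apply/word_leP => j; rewrite tnth_mktuple; have := le_ud j.
    by rewrite tnth_increment; case: eqP => // ->; rewrite ui.
  have le_aw : (least_raisable d i <= decrement u i)%O.
    apply/word_leP => j; rewrite !tnth_mktuple -(inj_eq val_inj).
    case: (ltngtP j i) => //= [lt_ij|eq_ij]; first by rewrite add1n -ui mu // ltnW.
    by rewrite (val_inj eq_ij) ui.
  rewrite !inE le_wd le_aw !andbT; apply/hillP; split=> [j|j k le_jk].
    exact: leq_trans (word_leP _ _ le_wd j) (dd j).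
  have := word_leP _ _ le_wd j; rewrite !tnth_mktuple => le_j.
  case: (k =P i) le_jk => [-> le_ji|_ le_jk].
    by rewrite ui; apply: leq_trans le_j (md _ _ le_ji).
  by apply: leq_trans (mu _ _ le_jk); case: eqP => // _; apply: leq_pred.
case=> [/andP[hu le_ud]|[w /atI[hw le_wd wi lt_w] ->]]; rewrite inE.
  by rewrite hu (le_trans le_ud) // ltW // lt_increment.
have le_wd' : (increment w i <= increment d i)%O.
  apply/word_leP => j; rewrite !tnth_increment.
  by have := word_leP _ _ le_wd j; case: eqP.
rewrite le_wd' andbT; apply/hillP; split=> [j|j k le_jk].
  exact: leq_trans (word_leP _ _ le_wd' j) (di j).
have [_ mw] := hillP _ hw; rewrite !tnth_increment.
have := mw _ _ le_jk; case: (j =P i) => [eq_ji|_]; case: (k =P i) => [_|/eqP neq_ki] //.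
  subst j => _; rewrite wi lt_w // ltn_neqAle le_jk andbT eq_sym.
  by rewrite (inj_eq val_inj).
by move/leqW.
Qed.

Lemma hill_constructible : constructible_by_interval_doubling H.
Proof.
have [c [sat_c _ _ _]] := greedy_chain bottom_hill top_hill (bottom_le top).
have: constructible_by_interval_doubling (hills_below top).
  move: bottom sat_c constructible_below_bottom.
  elim: c => [u -> //|w c IHc u /= [cov_uw /IHc{}IHc] con_u]; apply: IHc.
  have [hu hw _ _] := cov_uw; have [i def_w] := covers_increment cov_uw.
  by rewrite def_w in hw *; apply: constructible_below_increment.
case=> d' [Q [f [dblQ fM defQ]]]; exists d', Q, f; split=> // u.
by rewrite -defQ; split=> [hu|/andP[]//]; rewrite inE hu le_top.
Qed.

End Hills.

(** * Nestedness *)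

Section NestedHills.
Variables (delta : nat -> nat) (n : nat).
Hypothesis delta_incr : weakly_increasing delta.

Lemma tnth_append (w : n.-tuple nat) a (i : 'I_n.+1) :
  tnth (append w a) i = if i < n then nth 0 w i else a.
Proof.
rewrite (tnth_nth 0) nth_rcons size_tuple; case: ltngtP => // gt_in.
by have := ltn_ord i; rewrite ltnS leqNgt gt_in.
Qed.

Lemma append_last (z : word n.+1) :
  z = append [tuple nth 0 z i | i < n] (tnth z ord_max).
Proof.
apply: eq_from_tnth => i; rewrite tnth_append; case: ltnP => [lt_in|ge_in].
  by rewrite -[nat_of_ord i]/(val (Ordinal lt_in)) -tnth_nth tnth_mktuple -tnth_nth.
by congr (tnth _ _); apply: val_inj => /=; apply/eqP; rewrite eqn_leq ge_in -ltnS ltn_ord.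
Qed.

Lemma append_hill (w : word n) a :
  (append w a \in hill delta n.+1) =
  [&& w \in hill delta n, all (leq^~ a) w & a <= delta n.+1].
Proof.
apply/hillP/and3P => [[dwa mwa]|[/hillP[dw mw] /all_tnthP le_wa le_a]].
  have at_w (i : 'I_n) : tnth (append w a) (widen_ord (leqnSn n) i) = tnth w i.
    by rewrite tnth_append /= ltn_ord -tnth_nth.
  have at_last : tnth (append w a) ord_max = a by rewrite tnth_append ltnn.
  split; last by rewrite -at_last dwa.
    by apply/hillP; split=> [i|i j le_ij]; rewrite -!at_w; [apply: dwa | apply: mwa].
  by apply/all_tnthP => i; rewrite -at_w -[X in _ <= X]at_last mwa // leq_ord.
split=> [i|i j le_ij]; rewrite !tnth_append.
  case: ltnP => [lt_in|ge_in]; first by have := dw (Ordinal lt_in); rewrite (tnth_nth 0).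
  suff -> : i = n :> nat by [].
  by apply/eqP; rewrite eqn_leq ge_in -ltnS ltn_ord.
case: (ltnP j n) => [lt_jn|_].
  have lt_in := leq_ltn_trans le_ij lt_jn; rewrite lt_in.
  by have := mw (Ordinal lt_in) (Ordinal lt_jn) le_ij; rewrite !(tnth_nth 0).
case: ltnP => // lt_in.
by have := le_wa (Ordinal lt_in); rewrite (tnth_nth 0).
Qed.

Lemma append_le (w w' : word n) a b :
  (append w a <= append w' b)%O = (w <= w')%O && (a <= b).
Proof.
apply/word_leP/andP => [le_wa|[/word_leP le_w le_a] i]; last first.
  rewrite !tnth_append; case: ltnP => // lt_in.
  by have := le_w (Ordinal lt_in); rewrite !(tnth_nth 0).
split; last by have := le_wa ord_max; rewrite !tnth_append ltnn.
apply/word_leP => i; have := le_wa (widen_ord (leqnSn n) i).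
by rewrite !tnth_append /= ltn_ord -!tnth_nth.
Qed.

Lemma hill_nested : nested (hill delta n.+1).
Proof.
exists (delta n.+1).
  split; last by move=> u /hillP[/(_ ord_max)].
  by exists (top delta n.+1); [apply: top_hill | rewrite tnth_mktuple].
move=> a le_a.
have hill0 b : b <= delta n.+1 -> append [tuple of nseq n 0] b \in hill delta n.+1.
  move=> le_b; rewrite append_hill le_b andbT; apply/andP; split.
    by apply/hillP; split=> [i|i j _]; rewrite !tnth_nseq.
  by apply/all_tnthP => i; rewrite tnth_nseq.
have sub z : relast (hill delta n.+1) a (delta n.+1) z -> z \in hill delta n.+1.
  case=> w; rewrite append_hill => /and3P[hw le_wa _] ->.
  rewrite append_hill hw leqnn andbT /=.
  by apply: sub_all le_wa => x /leq_trans; apply.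
split=> //; first exact: hill0.
(* The largest w such that wa is a hill. *)
pose w_max : word n := [tuple minn (delta i.+1) a | i < n].
have h_max : append w_max a \in hill delta n.+1.
  rewrite append_hill le_a andbT; apply/andP; split; last first.
    by apply/all_tnthP => i; rewrite tnth_mktuple geq_minr.
  apply/hillP; split=> [i|i j le_ij]; rewrite !tnth_mktuple ?geq_minl //.
  by rewrite leq_min geq_minr geq_min (delta_homo delta_incr le_ij).
exists (append [tuple of nseq n 0] (delta n.+1)), (append w_max (delta n.+1)).
split; [exact: hill0 | by apply: sub; exists w_max | move=> z; split].
  move=> relast_z; split; first exact: sub.
  case: relast_z => w; rewrite append_hill => /and3P[/hillP[dw _] /all_tnthP le_wa _] ->.
  rewrite !append_le leqnn !andbT; apply/andP; split; apply/word_leP => i.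
    by rewrite tnth_nseq.
  by rewrite tnth_mktuple leq_min dw le_wa.
rewrite [z]append_last; move: [tuple _ | _ < _] (tnth z _) => w b [].
rewrite append_hill !append_le => /and3P[hw _ _].
case/andP=> [/andP[_ ge_b] /andP[/word_leP le_w le_b]].
have -> : b = delta n.+1 by apply: anti_leq; rewrite le_b.
exists w => //.
rewrite append_hill hw le_a andbT; apply/all_tnthP => i.
by have := le_w i; rewrite tnth_mktuple leq_min => /andP[].
Qed.
End NestedHills.

(** * The properties of the poset of hills *)

Theorem proposition2p2p3 (delta : nat -> nat)
    (delta_incr : weakly_increasing delta) (n : nat) :
  (straight (hill delta n) /\
   forall u v : word n, u \in hill delta n -> v \in hill delta n ->
     (covers (hill delta n) u v <-> exists i : 'I_n, v = increment u i)) /\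
  coated (hill delta n) /\
  (forall k : nat, n = k.+1 -> nested (hill delta k.+1)) /\
  (graded (hill delta n) /\ rank_function (hill delta n) (@weight n)) /\
  EL_shellable (hill delta n) /\
  sublattice (hill delta n) (cliff delta n) /\
  constructible_by_interval_doubling (hill delta n).
Proof.
split; first by split; [apply: hill_straight | apply: covers_hillP].
split; first exact: hill_coated.
split; first by move=> k _; apply: hill_nested.
split; first by split; [apply: hill_graded | apply: weight_rank].
split; first exact: hill_EL_shellable.
split; first exact: hill_sublattice.
exact: hill_constructible.
Qed.
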